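(* Let $(\mathbf{X},Y)$ be a $(d+1)$-dimensional random vector with continuous univariate marginal distribution functions $F_i$ of $X_i$, $i\in\{1,\dots,d\}$, and $G$ of $Y$, and connecting copula $A\in\mathcal{C}^{d+1}$. Put $\mathbf{U}=(F_1(X_1),\dots,F_d(X_d))$ and $V=G(Y)$. Then $$R^2(V,\mathbf{U})=\varrho_S(\psi(A)),$$ where $\varrho_S:\mathcal{C}^2\to\mathbb{R}$ denotes Spearman's rho, given by $$\varrho_S(C)=12\int_{\mathbb{I}^2}C(s,t)\,\mathrm{d}\lambda^2(s,t)-3=12\int_{\mathbb{I}^2}st\,\mathrm{d}\mu_C(s,t)-3.$$
   Context: Let $\mathbb{I}=[0,1]$, $d\ge 1$ an integer, $\lambda^k$ the $k$-dimensional Lebesgue measure. $\mathcal{C}^{k}$ is the family of all $k$-dimensional copulas; for a copula $C$, $\mu_C$ is the probability measure with distribution function $C$. For $A\in\mathcal{C}^{d+1}$, $A^{1:d}$ is the marginal of $A$ with respect to the first $d$ coordinates (for $d=1$, $\mu_{A^{1:d}}$ is Lebesgue measure on $\mathbb{I}$); $K_A:\mathbb{I}^d\times\mathcal{B}(\mathbb{I})\to\mathbb{I}$ is (a version of) the Markov kernel of $A$, i.e. the regular conditional distribution of the last coordinate given the first $d$ coordinates. The map $\psi:\mathcal{C}^{d+1}\to\mathcal{C}^2$ is defined by $$\psi(A)(s,t)=\int_{\mathbb{I}^d}K_A(\mathbf{u},[0,s])\,K_A(\mathbf{u},[0,t])\,\mathrm{d}\mu_{A^{1:d}}(\mathbf{u}),\qquad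 (s,t)\in\mathbb{I}^2.$$ For square-integrable $Z$ with positive variance and a random vector $\mathbf{W}$, $R^2(Z,\mathbf{W})=\mathrm{var}(E(Z\mid\mathbf{W}))/\mathrm{var}(Z)$. The connecting copula of $(\mathbf{X},Y)$ is the distribution function of $(\mathbf{U},V)$. *)

(* Defs.v *)
From HB Require Import structures.
From mathcomp Require Import all_boot all_order all_algebra.
From mathcomp Require Import all_classical all_reals all_analysis.

Set Implicit Arguments.
Unset Strict Implicit.
Unset Printing Implicit Defensive.

Import Order.TTheory GRing.Theory Num.Theory.
Import numFieldNormedType.Exports.

Local Open Scope classical_set_scope.
Local Open Scope ring_scope.

Section copulas.
Context {R : realType}.

Definition cube (k : nat) : set (k.-tuple R) :=
  [set u | forall i, tnth u i \in `[0, 1]].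

Definition lower_orthant (k : nat) (u : k.-tuple R) : set (k.-tuple R) :=
  [set x | forall i, tnth x i <= tnth u i].

(* Functions on I^k are represented by functions on R^k that are only ever
   evaluated on the cube.  The univariate margins of [mu] are uniform on [0, 1]
   (hence [mu] is concentrated on the cube) and [C] is the distribution function
   of [mu]. *)
Definition copula_law (k : nat) (C : k.-tuple R -> R)
    (mu : probability (k.-tuple R) R) : Prop :=
  (forall (i : 'I_k) (B : set R), measurable B ->
     mu [set x | B (tnth x i)] = uniform_prob (@ltr01 R) B) /\
  (forall u, cube u -> mu (lower_orthant u) = (C u)%:E).

Definition copula (k : nat) (C : k.-tuple R -> R) : Prop :=
  exists mu, copula_law C mu.

(* The law mu_C of a copula C (it is unique); a junk value if C is not a
   copula. *)
Definition copula_measure (k : nat) (C : k.-tuple R -> R) :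
    probability (k.-tuple R) R :=
  get [set mu | copula_law C mu].

Definition init_tuple (d : nat) (x : d.+1.-tuple R) : d.-tuple R :=
  [tuple tnth x (widen_ord (leqnSn d) i) | i < d].

(* The marginal A^{1:d}. *)
Definition init_marginal (d : nat) (A : d.+1.-tuple R -> R) : d.-tuple R -> R :=
  fun u => A [tuple of rcons u 1].

(* [K] is a version of the regular conditional distribution of the last
   coordinate given the first [d] ones under mu_A. *)
Definition markov_kernel_of (d : nat) (A : d.+1.-tuple R -> R)
    (K : R.-pker (d.-tuple R) ~> R) : Prop :=
  forall (E : set (d.-tuple R)) (F : set R), measurable E -> measurable F ->
    copula_measure A [set x | E (init_tuple x) /\ F (tnth x ord_max)] =
    (\int[copula_measure (init_marginal A)]_(u in E) K u F)%E.

Definition psi (d : nat) (A : d.+1.-tuple R -> R)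
    (K : R.-pker (d.-tuple R) ~> R) : 2.-tuple R -> R :=
  fun st =>
    \int[copula_measure (init_marginal A)]_(u in @cube d)
      (fine (K u `[0, tnth st ord0]%classic) * fine (K u `[0, tnth st ord_max]%classic)).

Definition spearman_rho (C : 2.-tuple R -> R) : R :=
  12 * (\int[(@lebesgue_measure R \x @lebesgue_measure R)%E]_(
          z in `[0, 1] `*` `[0, 1]) C [tuple z.1; z.2]) - 3.

End copulas.

Section random_vectors.
Context d (T : measurableType d) (R : realType) (P : probability T R).

(* The sigma-algebra generated by W consists of the preimages of measurable
   sets under W. *)
Definition is_cond_expectation d' (T' : measurableType d') (Z : T -> R)
    (W : T -> T') (H : T -> R) : Prop :=
  [/\ P.-integrable setT (EFin \o H),
      forall B : set R, measurable B ->
        preimage_set_system setT W measurable (H @^-1` B) &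
      forall B : set T', measurable B ->
        (\int[P]_(w in W @^-1` B) (H w)%:E =
         \int[P]_(w in W @^-1` B) (Z w)%:E)%E].

(* A version of E(Z | W); versions agree almost surely. *)
Definition cond_expectation d' (T' : measurableType d') (Z : T -> R)
    (W : T -> T') : T -> R :=
  xget (cst 0) [set H | is_cond_expectation Z W H].

Definition R2 d' (T' : measurableType d') (Z : T -> R) (W : T -> T') : R :=
  fine ('V_P[cond_expectation Z W]) / fine ('V_P[Z]).

(* The probability integral transform F(X) of X, for F the distribution
   function of X. *)
Definition pit (X : {RV P >-> R}) : T -> R := fun w => fine (cdf X (X w)).

Definition pit_vector (n : nat) (X : 'I_n -> {RV P >-> R}) : T -> n.-tuple R :=
  fun w => [tuple pit (X i) w | i < n].

Definition joint_df (k : nat) (W : T -> k.-tuple R) : k.-tuple R -> R :=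
  fun u => fine (P (W @^-1` lower_orthant u)).

Definition connecting_copula (n : nat) (X : 'I_n -> {RV P >-> R})
    (Y : {RV P >-> R}) : n.+1.-tuple R -> R :=
  joint_df (fun w => [tuple of rcons (pit_vector X w) (pit Y w)]).

End random_vectors.

(* Main.v *)
Require Import Defs.
From HB Require Import structures.
From mathcomp Require Import all_boot all_order all_algebra.
From mathcomp Require Import all_classical all_reals all_analysis.
From mathcomp Require Import measurable_realfun ring lra.

Set Implicit Arguments.
Unset Strict Implicit.
Unset Printing Implicit Defensive.

Import Order.TTheory GRing.Theory Num.Theory.
Import numFieldNormedType.Exports.

Local Open Scope classical_set_scope.
Local Open Scope ring_scope.

(** Write U for the vector of transformed covariates and V for the transformed
    response.  Because the univariate distribution functions are continuous, V
    and the coordinates of U are uniform on [0, 1] ([probability_pit]), so the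
    laws of (U, V) and of U are the measures of the connecting copula and of its
    initial marginal ([connecting_copula_law], [init_marginal_law]); a copula
    determines its measure because lower orthants generate the Borel sets of
    R^k ([copula_law_unique]).  Hence the kernel K disintegrates the law of
    (U, V) along U ([markov_kernel_pit]).

    Everything else is Tonelli.  Put g(u) = int_0^1 K(u, [0, s]) ds.  Since
    int_0^1 1{V <= s} ds = 1 - V, the disintegration shows that g(U) is the
    conditional expectation of 1 - V, so 1 - g(U) is a version of E(V | U)
    ([kernel_mean_is_cond_expectation]).  On the other hand the integral of
    psi(A) over the unit square is the integral over u of
    (int_0^1 K(u, [0, s]) ds) (int_0^1 K(u, [0, t]) dt), that is E(g(U)^2)
    ([spearman_rho_mixture], [psiE]).  Since E(g(U)) = 1/2 and var(V) = 1/12,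

      R^2(V, U) = (E(g(U)^2) - 1/4) / (1/12) = 12 E(g(U)^2) - 3
                = rho_S(psi(A)).

    The same Tonelli argument, applied to C(s, t) = P(S <= s, T <= t) with
    (S, T) distributed as the copula C, gives
    rho_S(C) = 12 E((1 - S) (1 - T)) - 3 = 12 E(S T) - 3
    ([spearman_rho_product_moment]).

    Finally psi(A) is a copula because it is the distribution function of two
    draws from K(u, .) that are independent given u, with u distributed as U
    ([conditional_copies]); each draw has the law of V. *)

(** * Laws on the line and on tuples are determined by lower orthants *)

Section generators.
Context {R : realType}.

Lemma measurable_rays :
  @measurable _ R = <<s [set `]-oo, a]%classic | a in [set: R]] >>.
Proof.
rewrite [LHS]RGenOInfty.measurableE eqEsubset; split.
  apply: smallest_sub; first exact: smallest_sigma_algebra.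
  move=> _ [x ->]; rewrite -setCitvl; apply: sigma_algebraC.
  by apply: sub_sigma_algebra; exists x.
apply: smallest_sub; first exact: smallest_sigma_algebra.
move=> _ [x _ <-]; rewrite -setCitvr; apply: sigma_algebraC.
by apply: sub_sigma_algebra; exists x.
Qed.

Lemma eq_probability_rays (m1 m2 : probability R R) :
  (forall a, m1 `]-oo, a]%classic = m2 `]-oo, a]%classic) ->
  forall B, measurable B -> m1 B = m2 B.
Proof.
move=> m12 B mB.
apply: (measure_unique [set `]-oo, a]%classic | a in [set: R]]
  (fun n => `]-oo, n%:R]%classic)) => //.
- exact: measurable_rays.
- move=> _ _ [a _ <-] [b _ <-]; exists (Num.min a b) => //.
  by rewrite eqEsubset; split => x /=; rewrite !in_itv/= le_min => /andP.
- rewrite eqEsubset; split => // x _; exists (Num.truncn `|x|).+1 => //=.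
  rewrite in_itv/= (le_trans (ler_norm _))// ltW//.
  by have /andP[] := truncn_itv (normr_ge0 x).
- by move=> _ [a _ <-]; exact: m12.
- by move=> k; rewrite (le_lt_trans (probability_le1 _ _)) ?ltry.
Qed.

Lemma measurable_lower_orthant (k : nat) (u : k.-tuple R) :
  measurable (lower_orthant u).
Proof.
rewrite (_ : lower_orthant u =
    \bigcap_(i in [set: 'I_k]) ((@tnth _ R ^~ i) @^-1` `]-oo, tnth u i]%classic)).
  apply: fin_bigcap_measurable => // i _.
  by rewrite -[X in measurable X]setTI; exact: measurable_tnth.
rewrite eqEsubset; split=> x /= xu.
  by move=> i _ /=; rewrite in_itv/=.
by move=> i; have := xu i Logic.I; rewrite /= in_itv.
Qed.

Lemma lower_orthantI (k : nat) (u v : k.-tuple R) :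
  lower_orthant u `&` lower_orthant v =
  lower_orthant [tuple Num.min (tnth u i) (tnth v i) | i < k].
Proof.
rewrite eqEsubset; split=> x /=.
  by move=> [xu xv] i; rewrite tnth_mktuple le_min xu xv.
move=> xuv; split=> i; have := xuv i; rewrite tnth_mktuple le_min => /andP[]//.
Qed.

Lemma bigcup_lower_orthant (k : nat) :
  \bigcup_n lower_orthant [tuple n%:R : R | i < k] = setT.
Proof.
rewrite eqEsubset; split => // x _.
exists (Num.truncn (\sum_(i < k) `|tnth x i|)).+1 => //= i.
rewrite tnth_mktuple (le_trans (ler_norm _))// ltW//.
have sum_ge0 (Q : pred 'I_k) : 0 <= \sum_(i < k | Q i) `|tnth x i|.
  by apply: sumr_ge0.
apply: le_lt_trans (proj2 (andP (truncn_itv (sum_ge0 _)))).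
by rewrite (bigD1 i)//= lerDl.
Qed.

(** A coordinate half-space is the increasing union of the orthants whose
    other coordinates tend to infinity. *)
Lemma measurable_tuple_lower_orthants (k : nat) :
  @measurable _ (k.-tuple R) = <<s range (@lower_orthant R k) >>.
Proof.
rewrite eqEsubset; split; last first.
  apply: smallest_sub; first exact: sigma_algebra_measurable.
  by move=> _ [u _ <-]; exact: measurable_lower_orthant.
apply: smallest_sub; first exact: smallest_sigma_algebra.
case: k => [|k]; first by rewrite big_ord0.
rewrite -bigcup_mkord_ord; apply: bigcup_sub => i _.
set f := fun x : k.+1.-tuple R => tnth x (inord i).
set G := range _.
have mf : measurable_fun [set: g_sigma_algebraType G] (f : g_sigma_algebraType G -> R).
  apply: (measurability _ measurable_rays) => _ [_ [a _ <-] <-].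
  rewrite setTI.
  rewrite (_ : f @^-1` _ = \bigcup_n (lower_orthant
      [tuple if j == inord i then a else n%:R | j < k.+1])); last first.
    rewrite eqEsubset; split=> x /=.
      rewrite in_itv/= => fxa.
      have : [set: k.+1.-tuple R] x by [].
      rewrite -bigcup_lower_orthant => -[n _ /= xn].
      exists n => //= j; rewrite tnth_mktuple; case: ifP => [/eqP->//|_].
      by have := xn j; rewrite tnth_mktuple.
    move=> [n _ /= xn]; rewrite in_itv/=.
    by have := xn (inord i); rewrite tnth_mktuple eqxx.
  by apply: bigcupT_measurable => n; apply: sub_sigma_algebra; eexists.
move=> _ [B mB <-].
exact: mf.
Qed.

Lemma eq_probability_lower_orthants (k : nat) (m1 m2 : probability (k.-tuple R) R) :
  (forall u, m1 (lower_orthant u) = m2 (lower_orthant u)) ->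
  forall B, measurable B -> m1 B = m2 B.
Proof.
move=> m12 B mB.
apply: (measure_unique (range (@lower_orthant R k))
  (fun n => lower_orthant [tuple n%:R : R | i < k])) => //.
- exact: measurable_tuple_lower_orthants.
- by move=> _ _ [u _ <-] [v _ <-]; rewrite lower_orthantI; eexists.
- exact: bigcup_lower_orthant.
- by move=> _ [u _ <-]; exact: m12.
- move=> n; rewrite (le_lt_trans (probability_le1 _ _)) ?ltry//.
  exact: measurable_lower_orthant.
Qed.

End generators.

Section copula_law.
Context {R : realType}.
Local Notation unif := (uniform_prob (@ltr01 R)).

Lemma uniform_prob_itv01 : unif `[0, 1]%classic = 1%E.
Proof. by rewrite /uniform_prob integral_uniform_pdf1. Qed.

Lemma measurable_cube (k : nat) : measurable (@cube R k).
Proof.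
rewrite (_ : @cube R k =
    \bigcap_(i in [set: 'I_k]) ((@tnth _ R ^~ i) @^-1` `[0, 1]%classic)).
  apply: fin_bigcap_measurable => // i _.
  by rewrite -[X in measurable X]setTI; exact: measurable_tnth.
rewrite eqEsubset; split=> x /= xu; first by move=> i _ /=.
by move=> i; have := xu i Logic.I.
Qed.

Lemma probability_setI_conull d (T : measurableType d) (mu : probability T R)
    (D A : set T) :
  measurable D -> measurable A -> mu D = 1%E -> mu (A `&` D) = mu A.
Proof.
move=> mD mA D1.
have D0 : mu (A `&` ~` D) = 0%E.
  apply/eqP; rewrite -measure_le0.
  have <- : mu (~` D) = 0%E by rewrite probability_setC// D1 subee.
  by rewrite le_measure ?inE//; [apply: measurableI => //; exact: measurableC|
    exact: measurableC].
rewrite -[in RHS](setIT A) -(setUv D) setIUr measureU//.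
- by rewrite -[LHS]adde0 -[in LHS]D0.
- exact: measurableI.
- by apply: measurableI => //; exact: measurableC.
- by rewrite setIACA setICr setI0.
Qed.

Lemma copula_law_coord01 (k : nat) (C : k.-tuple R -> R)
    (mu : probability (k.-tuple R) R) (i : 'I_k) :
  copula_law C mu -> mu [set x | tnth x i \in `[0, 1]] = 1%E.
Proof.
move=> [mu_unif _].
by rewrite -uniform_prob_itv01 -(mu_unif i _ (measurable_itv _)).
Qed.

Lemma copula_law_cube (k : nat) (C : k.-tuple R -> R)
    (mu : probability (k.-tuple R) R) :
  copula_law C mu -> mu (@cube R k) = 1%E.
Proof.
move=> Cmu.
have aei (i : 'I_k) : {ae mu, forall x, tnth x i \in `[0, 1]}.
  have m01 : measurable [set x : k.-tuple R | tnth x i \in `[0, 1]].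
    rewrite -[X in measurable X]setTI.
    exact: (measurable_tnth i measurableT (measurable_itv `[0, 1])).
  apply/negligibleP; first exact: measurableC.
  have := probability_setC mu m01.
  by rewrite (copula_law_coord01 _ Cmu) subee.
have mcube := @measurable_cube k.
have cube0 : mu (~` @cube R k) = 0%E.
  apply/negligibleP; first exact: measurableC.
  exact: (@filter_forall _ _ (fun i x => tnth x i \in `[0, 1]) _
    (ae_filter_ringOfSetsType mu) aei).
rewrite -[LHS]adde0 -cube0 -measureU//; last 2 first.
- exact: measurableC.
- exact: setICr.
by rewrite setUv; exact: (probability_setT mu).
Qed.

(** Corners may be clamped to the cube: a negative coordinate makes the orthant
    null, and a coordinate above 1 may be lowered to 1 up to a null set. *)
Lemma copula_law_unique (k : nat) (C : k.-tuple R -> R)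
    (m1 m2 : probability (k.-tuple R) R) :
  copula_law C m1 -> copula_law C m2 ->
  forall B, measurable B -> m1 B = m2 B.
Proof.
pose clamp (u : k.-tuple R) := [tuple Num.min (tnth u i) 1 | i < k].
have clampE m u : copula_law C m -> (forall i, 0 <= tnth u i) ->
    m (lower_orthant u) = (C (clamp u))%:E.
  move=> Cm u0; rewrite -Cm.2; last first.
    move=> i; rewrite tnth_mktuple in_itv/= ge_min lexx orbT andbT.
    by rewrite le_min u0 ler01.
  have mcube := @measurable_cube k.
  rewrite -(probability_setI_conull mcube (measurable_lower_orthant u)
    (copula_law_cube Cm)) -[RHS](probability_setI_conull mcube _
    (copula_law_cube Cm)); last exact: measurable_lower_orthant.
  congr (m _); rewrite eqEsubset; split=> x /= [xu xc]; split=> // i.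
    rewrite tnth_mktuple le_min xu/=.
    by have := xc i; rewrite in_itv/= => /andP[].
  by have := xu i; rewrite tnth_mktuple le_min => /andP[].
have negE m u : copula_law C m -> (exists i, tnth u i < 0) ->
    m (lower_orthant u) = 0%E.
  move=> Cm [i ui].
  rewrite -(probability_setI_conull (@measurable_cube k)
    (measurable_lower_orthant u) (copula_law_cube Cm)).
  rewrite (_ : _ `&` _ = set0) ?measure0// -subset0 => x [/= xu xc].
  have := xc i; rewrite in_itv/= => /andP[x0 _].
  by have := le_lt_trans (le_trans x0 (xu i)) ui; rewrite ltxx.
move=> Cm1 Cm2; apply: eq_probability_lower_orthants => u.
have [[i ui]|u0] := pselect (exists i, tnth u i < 0).
  by rewrite !negE//; exists i.
by rewrite !clampE// => i; rewrite leNgt; apply/negP => ui; apply: u0; exists i.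
Qed.

End copula_law.

(** * The probability integral transform *)

Section probability_integral_transform.
Context {R : realType}.
Local Notation unif := (uniform_prob (@ltr01 R)).
Local Notation leb := (@lebesgue_measure R).

Lemma uniform_prob_ray (a : R) :
  unif `]-oo, a]%classic = (Num.max 0 (Num.min a 1))%:E.
Proof.
have -> : unif `]-oo, a]%classic = leb (`]-oo, a]%classic `&` `[0, 1]%classic).
  rewrite /uniform_prob integral_uniform_pdf.
  rewrite (eq_integral (cst 1%E)); last first.
    move=> x; rewrite inE/= => -[_]; rewrite in_itv/= /uniform_pdf => ->.
    by rewrite subr0 invr1.
  by rewrite integral_cst ?mul1e//; apply: measurableI; exact: measurable_itv.
have -> : `]-oo, a]%classic `&` `[0, 1]%classic = `[0, Num.min a 1]%classic.
  rewrite eqEsubset; split=> x /=; rewrite !in_itv/= le_min.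
    by move=> [-> /andP[-> ->]].
  by move=> /and3P[-> -> ->].
rewrite lebesgue_measure_itv/= lte_fin; case: ltP => [a0|a0].
  by rewrite sube0.
by [].
Qed.

Context dT (T : measurableType dT) (P : probability T R) (X : {RV P >-> R}).

Lemma measurable_pit : measurable_fun [set: T] (pit X).
Proof.
apply: (measurableT_comp (f := fine \o cdf X)); last by [].
by apply: measurableT_comp => //; exact: cdf_measurable.
Qed.

Lemma pit_itv01 (w : T) : 0 <= pit X w <= 1.
Proof.
rewrite /pit fine_ge0 ?cdf_ge0//= -[leRHS]/(fine 1%:E).
by rewrite fine_le ?cdf_le1 ?fin_num_measure.
Qed.

Hypothesis contX : continuous (cdf X).

Let F (x : R) : R := fine (cdf X x).

Let FE x : (F x)%:E = cdf X x.
Proof. by rewrite /F fineK// fin_num_measure. Qed.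

Let F_nd x y : x <= y -> F x <= F y.
Proof. by move=> xy; rewrite -lee_fin !FE; exact: cdf_nondecreasing. Qed.

Let F_cont : continuous F.
Proof. by move=> x; apply: fine_cvg; rewrite FE; exact: contX. Qed.

Let F_onto (t : R) : 0 < t < 1 -> exists x, F x = t.
Proof.
move=> /andP[t0 t1].
have FNy : F @ -oo --> (0:R) by exact/fine_cvg/cvg_cdfNy0.
have Fy : F @ +oo --> (1:R) by exact/fine_cvg/cvg_cdfy1.
have [a [_ Fa]] : exists a, a <= 0 /\ F a < t.
  have : \forall a \near -oo, F a < t.
    exact: (cvgr_lt _ FNy).
  move=> lt_t; near (-oo : set_system R) => a.
  exists a; split; first by near: a; exact: nbhs_ninfty_le.
  by near: a.
have [b [_ Fb]] : exists b, 0 <= b /\ t < F b.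
  have : \forall b \near +oo, t < F b.
    exact: (cvgr_gt _ Fy).
  move=> lt_t; near (+oo : set_system R) => b.
  exists b; split; first by near: b; exact: nbhs_pinfty_ge.
  by near: b.
have ab : a <= b.
  rewrite leNgt; apply/negP => /ltW/F_nd Fba.
  by have := lt_trans (le_lt_trans Fba Fa) Fb; rewrite ltxx.
have [||c _ <-] := @IVT _ F a b t ab.
- by apply: continuous_subspaceT => x; exact: F_cont.
- by rewrite ge_min le_max (ltW Fa) (ltW Fb) orbT.
by exists c.
Unshelve. all: by end_near. Qed.

Let measurable_pit_le t : measurable [set w | pit X w <= t].
Proof.
rewrite -[X in measurable X]setTI.
exact: (measurable_pit measurableT (measurable_itv `]-oo, t])).
Qed.

Let measurable_pit_lt t : measurable [set w | pit X w < t].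
Proof.
rewrite -[X in measurable X]setTI.
exact: (measurable_pit measurableT (measurable_itv `]-oo, t[)).
Qed.

Let measurable_X_le t : measurable (X @^-1` `]-oo, t]).
Proof. by rewrite -[X in measurable X]setTI; exact: measurable_funPT. Qed.

Let pit_le_lb (t : R) : 0 < t < 1 -> (t%:E <= P [set w | (pit X w <= t)%R])%E.
Proof.
move=> /F_onto[x Fx]; rewrite -[in leLHS]Fx FE.
rewrite -[leLHS]/(P (X @^-1` `]-oo, x])).
rewrite le_measure ?inE// => w /=; rewrite in_itv/= => /F_nd.
by rewrite Fx.
Qed.

Let pit_lt_ub (t : R) : 0 < t < 1 -> (P [set w | (pit X w < t)%R] <= t%:E)%E.
Proof.
move=> /F_onto[x Fx]; rewrite -[in leRHS]Fx FE.
rewrite -[leRHS]/(P (X @^-1` `]-oo, x])).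
rewrite le_measure ?inE// => w /=; rewrite in_itv/= => Xt.
by rewrite leNgt; apply/negP => /ltW/F_nd; rewrite Fx leNgt => /negP; exact.
Qed.

(** Where the distribution function F is flat, the event F(X) <= F(x) is larger
    than X <= x, so each event only yields one inequality: P(F(X) <= t) >= t and
    P(F(X) < t) <= t.  Comparing the level t with slightly larger levels gives
    equality. *)
Lemma probability_pit (B : set R) : measurable B ->
  P (pit X @^-1` B) = unif B.
Proof.
pose V : {mfun T >-> R} :=
  HB.pack (pit X) (isMeasurableFun.Build _ _ _ _ _ measurable_pit).
move=> mB.
(* The uniform law lives on a copy of the line with its own display; the identity
   transports it to [R]. *)
have mid : measurable_fun [set: measurableTypeR R] (id : measurableTypeR R -> R).
  by move=> _ A mA; rewrite setTI.
pose idR : {mfun (measurableTypeR R) >-> R} :=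
  HB.pack (id : measurableTypeR R -> R) (isMeasurableFun.Build _ _ _ _ _ mid).
suff raysE t : distribution P V `]-oo, t]%classic = unif `]-oo, t]%classic.
  exact: (@eq_probability_rays _ (distribution P V) (distribution unif idR) raysE _ mB).
rewrite uniform_prob_ray.
have -> : distribution P V `]-oo, t]%classic = P [set w | pit X w <= t].
  by congr (P _); rewrite eqEsubset; split=> w /=; rewrite in_itv.
have [t0|t0] := ltP t 0.
  rewrite max_l ?ge_min ?(ltW t0)// (_ : [set _ | _] = set0) ?measure0//.
  rewrite -subset0 => w /= pt; have /andP[p0 _] := pit_itv01 w.
  by have := le_lt_trans (le_trans p0 pt) t0; rewrite ltxx.
have [t1|t1] := leP 1 t.
  rewrite max_r// (_ : [set _ | _] = setT) ?probability_setT//.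
  rewrite -subTset => w _ /=; have /andP[_ p1] := pit_itv01 w.
  exact: le_trans p1 t1.
rewrite max_r//.
apply/eqP; rewrite eq_le; apply/andP; split; last first.
  have [->|tneq0] := eqVneq t 0; first exact: measure_ge0.
  by apply: pit_le_lb; rewrite t1 andbT lt_neqAle eq_sym tneq0.
have PE : P [set w | (pit X w <= t)%R] = (fine (P [set w | (pit X w <= t)%R]))%:E.
  by rewrite fineK// fin_num_measure.
rewrite PE lee_fin; apply/ler_addgt0Pl => e e0.
(* A level above t and below 1, within e of t. *)
pose s := Num.min (e + t) ((t + 1) / 2).
have ts : t < s by rewrite lt_min ltrDr e0/=; lra.
have s1 : s < 1 by rewrite gt_min; apply/orP; right; lra.
apply: le_trans (_ : s <= _); last by rewrite ge_min lexx.
rewrite -lee_fin -PE (le_trans _ (pit_lt_ub _))//.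
  by rewrite le_measure ?inE// => w /= /le_lt_trans; exact.
by rewrite s1 (le_lt_trans t0 ts).
Qed.

End probability_integral_transform.

(** * Integrals against uniform laws *)

Section integrals.
Context {R : realType}.
Local Notation unif := (uniform_prob (@ltr01 R)).
Local Notation leb := (@lebesgue_measure R).

Lemma integral_itv01_exprn (n : nat) :
  (\int[leb]_(x in `[0%R, 1%R]) (x ^+ n)%:E = (n.+1%:R^-1)%:E)%E.
Proof.
pose F (x : R) := n.+1%:R^-1 * x ^+ n.+1.
have dF (z : R) : is_derive z 1 F (z ^+ n).
  have -> : F = n.+1%:R^-1 \*: ((id : R -> R) ^+ n.+1).
    by apply/funext => y; rewrite /F/= fctE.
  apply: is_derive_eq.
  by rewrite scalerA mulrA [LHS]mulr1 mulVf// mul1r.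
have cF : continuous F.
  by move=> x; apply/differentiable_continuous/derivable1_diffP; have [] := dF x.
rewrite (@continuous_FTC2 _ (fun x => x ^+ n) F)//.
- by rewrite /F expr1n expr0n/= mulr0 mulr1 sube0.
- by apply: continuous_subspaceT => x; exact: exprn_continuous.
- split.
  + by move=> x _; have [] := dF x.
  + by apply: cvg_at_right_filter; exact: cF.
  + by apply: cvg_at_left_filter; exact: cF.
- by move=> x _; rewrite derive1E; have [_ ->] := dF x.
Qed.

Context d (T : measurableType d) (P : probability T R).

Lemma ge0_integral_conull (D : set T) (f : T -> \bar R) :
  measurable D -> P D = 1%E -> measurable_fun [set: T] f ->
  (forall x, 0 <= f x)%E -> (\int[P]_(x in D) f x = \int[P]_x f x)%E.
Proof.
move=> mD D1 mf f0.
rewrite [RHS](@ge0_negligible_integral _ _ _ _ _ (~` D))//.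
- by rewrite setTD setCK.
- exact: measurableC.
- by rewrite [LHS]probability_setC// D1 subee.
Qed.

Lemma bounded_integrable (D : set T) (f : T -> R) (M : R) :
  measurable D -> measurable_fun D f -> (forall x, D x -> `|f x| <= M) ->
  P.-integrable D (EFin \o f).
Proof.
move=> mD mf fM; apply: measurable_bounded_integrable => //.
  by rewrite (le_lt_trans (probability_le1 _ _)) ?ltry.
by exists M; split; [exact: num_real|move=> r Mr x /fM/le_trans; apply; exact: ltW].
Qed.

Lemma ge0_integral_uniform_law (V : T -> R) (f : R -> \bar R) :
  measurable_fun [set: T] V ->
  (forall B, measurable B -> P (V @^-1` B) = unif B) ->
  measurable_fun [set: R] f -> (forall x, 0 <= f x)%E ->
  (\int[P]_w f (V w) = \int[leb]_(x in `[0%R, 1%R]) f x)%E.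
Proof.
move=> mV Vunif mf f0.
have mV' : measurable_fun [set: T] (V : T -> measurableTypeR R).
  by move=> _ A mA; exact: mV.
pose V' : {mfun T >-> measurableTypeR R} :=
  HB.pack (V : T -> measurableTypeR R) (isMeasurableFun.Build _ _ _ _ _ mV').
have mf' : measurable_fun [set: measurableTypeR R] (f : measurableTypeR R -> \bar R).
  by move=> _ A mA; exact: mf.
rewrite -[LHS](@ge0_integral_distribution _ _ _ _ _ P V' f)//.
rewrite (@eq_measure_integral _ _ _ _ unif) => [|A mA _]; last exact: Vunif.
by rewrite integral_uniform// subr0 invr1 mul1e.
Qed.

Lemma integral_uniform_law (D : set T) (V : T -> R) (f : R -> R) :
  measurable D -> P D = 1%E -> (forall w, D w -> 0 <= V w <= 1) ->
  measurable_fun [set: T] V ->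
  (forall B, measurable B -> P (V @^-1` B) = unif B) ->
  measurable_fun [set: R] f -> (forall x, 0 <= x <= 1 -> 0 <= f x) ->
  \int[P]_(w in D) f (V w) = \int[leb]_(x in `[0%R, 1%R]) f x.
Proof.
move=> mD D1 V01 mV Vunif mf f0; congr fine.
pose g (x : R) : \bar R := (f \_ `[0, 1] x)%:E.
have mg : measurable_fun [set: R] g.
  apply/measurable_EFinP; apply/(measurable_restrict _ _ _) => //.
  exact: measurable_funTS.
have g0 x : (0 <= g x)%E.
  rewrite lee_fin patchE; case: ifPn => // /set_mem/=; rewrite in_itv/=.
  exact: f0.
transitivity (\int[P]_(w in D) g (V w))%E.
  apply: eq_integral => w /set_mem Dw; rewrite /g patchE mem_set//=.
  by rewrite in_itv/= V01.
rewrite ge0_integral_conull//; last exact: measurableT_comp.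
rewrite ge0_integral_uniform_law//.
by apply: eq_integral => x x01; rewrite /g patchE x01.
Qed.

End integrals.

(** * Joint distribution functions of uniform random vectors *)

Section joint_df.
Context {R : realType} dT (T : measurableType dT) (P : probability T R).
Local Notation unif := (uniform_prob (@ltr01 R)).

Lemma joint_df_law (k : nat) (W : {mfun T >-> k.-tuple R}) :
  (forall (i : 'I_k) B, measurable B ->
    P ((fun w => tnth (W w) i) @^-1` B) = unif B) ->
  copula_law (joint_df P W) (distribution P W).
Proof.
move=> Wunif; split=> [i B mB|u _]; first exact: Wunif.
by rewrite /joint_df fineK// fin_num_measure// -[X in measurable X]setTI;
  apply: measurable_funPT => //; exact: measurable_lower_orthant.
Qed.

Context (n : nat) (X : 'I_n -> {RV P >-> R}) (Y : {RV P >-> R}).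

Definition pit_extended : T -> n.+1.-tuple R :=
  fun w => [tuple of rcons (pit_vector X w) (pit Y w)].

Lemma tnth_rcons_max (u : n.-tuple R) (v : R) :
  tnth [tuple of rcons u v] ord_max = v.
Proof. by rewrite (tnth_nth 0) nth_rcons size_tuple ltnn eqxx. Qed.

Lemma tnth_rcons_widen (u : n.-tuple R) (v : R) (i : 'I_n) :
  tnth [tuple of rcons u v] (widen_ord (leqnSn n) i) = tnth u i.
Proof. by rewrite !(tnth_nth 0) nth_rcons size_tuple/= ltn_ord. Qed.

Lemma init_tuple_rcons (u : n.-tuple R) (v : R) :
  init_tuple [tuple of rcons u v] = u.
Proof. by apply: eq_from_tnth => i; rewrite tnth_mktuple tnth_rcons_widen. Qed.

Lemma ord_widen_or_max (i : 'I_n.+1) :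
  i = ord_max \/ exists j, i = widen_ord (leqnSn n) j.
Proof.
have [i_n|i_n] := ltnP i n; first by right; exists (Ordinal i_n); exact: val_inj.
by left; apply: val_inj => /=; apply/eqP; rewrite eqn_leq -ltnS ltn_ord.
Qed.

Lemma measurable_pit_vector : measurable_fun [set: T] (pit_vector X).
Proof.
apply/measurable_fun_tnthP => i.
rewrite (_ : _ \o _ = pit (X i)); first exact: measurable_pit.
by apply/funext => w /=; rewrite tnth_mktuple.
Qed.

Lemma measurable_pit_extended : measurable_fun [set: T] pit_extended.
Proof.
apply/measurable_fun_tnthP => i.
have [->|[j ->]] := ord_widen_or_max i.
  rewrite (_ : _ \o _ = pit Y); first exact: measurable_pit.
  by apply/funext => w /=; rewrite tnth_rcons_max.
rewrite (_ : _ \o _ = pit (X j)); first exact: measurable_pit.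
by apply/funext => w /=; rewrite tnth_rcons_widen tnth_mktuple.
Qed.

HB.instance Definition _ := isMeasurableFun.Build _ _ _ _
  (pit_vector X) measurable_pit_vector.
HB.instance Definition _ := isMeasurableFun.Build _ _ _ _
  pit_extended measurable_pit_extended.

Hypothesis contX : forall i, continuous (cdf (X i)).
Hypothesis contY : continuous (cdf Y).

Lemma connecting_copula_law :
  copula_law (connecting_copula X Y) (distribution P pit_extended).
Proof.
apply: joint_df_law => i B mB.
have [->|[j ->]] := ord_widen_or_max i.
  rewrite (_ : (fun w => _) = pit Y); first exact: probability_pit.
  by apply/funext => w /=; rewrite tnth_rcons_max.
rewrite (_ : (fun w => _) = pit (X j)); first exact: probability_pit.
by apply/funext => w /=; rewrite tnth_rcons_widen tnth_mktuple.
Qed.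

(** Setting the last argument of the distribution function to 1 leaves the event
    unchanged, because the transforms take values in the unit interval. *)
Lemma init_marginal_law :
  copula_law (init_marginal (connecting_copula X Y)) (distribution P (pit_vector X)).
Proof.
have [Wunif WE] : copula_law (joint_df P (pit_vector X)) (distribution P (pit_vector X)).
  apply: joint_df_law => i B mB.
  rewrite (_ : (fun w => _) = pit (X i)); first exact: probability_pit.
  by apply/funext => w /=; rewrite tnth_mktuple.
split=> // u u01; rewrite WE//; congr (fine (P _))%:E.
rewrite eqEsubset; split=> w /= wu i.
  have [->|[j ->]] := ord_widen_or_max i.
    by rewrite !tnth_rcons_max; have /andP[] := pit_itv01 Y w.
  by rewrite !tnth_rcons_widen.
by have := wu (widen_ord (leqnSn n) i); rewrite !tnth_rcons_widen.
Qed.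

Lemma copula_measureE (k : nat) (C : k.-tuple R -> R)
    (mu : probability (k.-tuple R) R) (B : set (k.-tuple R)) :
  copula_law C mu -> measurable B -> copula_measure C B = mu B.
Proof.
move=> Cmu mB; apply: (copula_law_unique _ Cmu) => //.
by rewrite /copula_measure; apply: (@getPex _ [set mu | copula_law C mu]); exists mu.
Qed.

(** The measures of the connecting copula and of its marginal are the laws of
    (U, V) and U, so the kernel is a regular conditional distribution of V
    given U. *)
Lemma markov_kernel_pit (K : R.-pker (n.-tuple R) ~> R) :
  markov_kernel_of (connecting_copula X Y) K ->
  forall E F, measurable E -> measurable F ->
    P (pit_vector X @^-1` E `&` pit Y @^-1` F) =
    (\int[P]_(w in pit_vector X @^-1` E) K (pit_vector X w) F)%E.
Proof.
move=> hK E F mE mF.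
have := hK E F mE mF.
rewrite (copula_measureE connecting_copula_law); last first.
  have minit : measurable_fun [set: n.+1.-tuple R] (@init_tuple R n).
    apply/measurable_fun_tnthP => i.
    rewrite (_ : _ \o _ = (@tnth _ R ^~ (widen_ord (leqnSn n) i))).
      exact: measurable_tnth.
    by apply/funext => x /=; rewrite tnth_mktuple.
  rewrite [X in measurable X](_ : _ = (@init_tuple R n @^-1` E) `&`
    ((@tnth _ R ^~ ord_max) @^-1` F))//.
  apply: measurableI; first by rewrite -[X in measurable X]setTI; exact: minit.
  by rewrite -[X in measurable X]setTI; exact: measurable_tnth.
rewrite (@eq_measure_integral _ _ _ _ (distribution P (pit_vector X))); last first.
  by move=> A mA _; exact: (copula_measureE init_marginal_law).
rewrite ge0_integral_pushforward//; last first.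
  by apply: measurable_funTS; exact: measurable_kernel.
move=> <-; congr (P _); rewrite eqEsubset; split=> w /=;
  by rewrite init_tuple_rcons tnth_rcons_max.
Qed.

End joint_df.

(** * Spearman's rho of a mixture of products *)

Section tonelli.
Local Open Scope ereal_scope.
Context {R : realType} d1 d2 (T1 : measurableType d1) (T2 : measurableType d2)
  (m1 : {sigma_finite_measure set T1 -> \bar R})
  (m2 : {sigma_finite_measure set T2 -> \bar R}).
Variables (D : set T1) (E : set T2) (f : T1 * T2 -> \bar R).
Hypotheses (mD : measurable D) (mE : measurable E).
Hypotheses (mf : measurable_fun [set: T1 * T2] f) (f0 : forall p, 0 <= f p).

Let g := f \_ (D `*` E).

Let mg : measurable_fun [set: T1 * T2] g.
Proof.
apply/(measurable_restrict _ _ _) => //; first exact: measurableX.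
exact: measurable_funTS.
Qed.

Let g0 p : 0 <= g p.
Proof. by rewrite /g patchE; case: ifP. Qed.

Let gE x : \int[m2]_y g (x, y) = ((fun x => \int[m2]_(y in E) f (x, y)) \_ D) x.
Proof.
rewrite patchE; case: ifPn => [/set_mem xD|/negP xD].
  rewrite [RHS]integral_mkcond; apply: eq_integral => y _; rewrite /g !patchE.
  by case: ifPn => [/set_mem[_ /mem_set->]//|/negP xyN];
    case: ifPn => // /set_mem yE; exfalso; apply: xyN; exact/mem_set.
apply: integral0_eq => y _; rewrite /g patchE; case: ifPn => // /set_mem[/= Dx _].
by exfalso; apply: xD; exact/mem_set.
Qed.

Lemma integral_setX :
  \int[m1 \x m2]_(p in D `*` E) f p = \int[m1]_(x in D) \int[m2]_(y in E) f (x, y).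
Proof.
rewrite integral_mkcond (fubini_tonelli1 g)// [RHS]integral_mkcond.
by apply: eq_integral => x _; exact: gE.
Qed.

Lemma exchange_integral_on :
  \int[m1]_(x in D) \int[m2]_(y in E) f (x, y) =
  \int[m2]_(y in E) \int[m1]_(x in D) f (x, y).
Proof.
transitivity (\int[m1]_x \int[m2]_y g (x, y)).
  by rewrite [LHS]integral_mkcond; apply: eq_integral => x _; rewrite gE.
rewrite fubini_tonelli// [RHS]integral_mkcond; apply: eq_integral => y _.
rewrite patchE; case: ifPn => [/set_mem yE|/negP yE].
  rewrite [RHS]integral_mkcond; apply: eq_integral => x _; rewrite /g !patchE.
  by case: ifPn => [/set_mem[/mem_set-> _]//|/negP xyN];
    case: ifPn => // /set_mem xD; exfalso; apply: xyN; exact/mem_set.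
apply: integral0_eq => x _; rewrite /g patchE; case: ifPn => // /set_mem[_ /= Ey].
by exfalso; apply: yE; exact/mem_set.
Qed.

End tonelli.

Section mixture_of_products.
Local Open Scope ereal_scope.
Context {R : realType} d (T : measurableType d) (P : probability T R).
Local Notation leb := (@lebesgue_measure R).
Local Notation line := (measurableTypeR R).

Lemma integral_itv01_step (v : R) : (0 <= v <= 1)%R ->
  \int[leb]_(s in `[0%R, 1%R]) ((v <= s)%R%:R)%:E = (1 - v)%:E.
Proof.
move=> /andP[v0 v1].
transitivity (\int[leb]_(s in `[0%R, 1%R]) (\1_(`[v, 1%R]%classic : set R) s)%:E).
  apply: eq_integral => s /set_mem/=; rewrite in_itv/= indicE => /andP[s0 s1].
  rewrite (_ : (s \in _) = (v <= s)%R)//; apply/idP/idP => [/set_mem/=|vs].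
    by rewrite in_itv/= => /andP[].
  by apply/mem_set; rewrite /= in_itv/= vs.
rewrite integral_indic//= (_ : _ `&` _ = `[v, 1%R]%classic); last first.
  rewrite setIidl//; apply: subset_itvr; by rewrite bnd_simp.
rewrite lebesgue_measure_itv/= lte_fin; case: ltP => //.
by move=> /(conj v1)/andP/le_anti<-; rewrite subrr.
Qed.

Lemma measurable_step (V : T -> R) : measurable_fun [set: T] V ->
  measurable_fun [set: T * line] (fun p => ((V p.1 <= p.2)%R%:R)%:E : \bar R).
Proof.
move=> mV.
have mB : measurable [set p : T * line | (V p.1 <= p.2)%R].
  rewrite -[X in measurable X]setTI.
  apply: (measurable_fun_ler (f := V \o fst) (g := snd)) => //.
  - exact: measurableT_comp.
apply/measurable_EFinP.
rewrite (_ : (fun _ => _) = \1_[set p : T * line | (V p.1 <= p.2)%R]).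
  exact: measurable_indic.
apply/funext => p; rewrite indicE (_ : (p \in _) = (V p.1 <= p.2)%R)//.
by apply/idP/idP => [/set_mem|/mem_set].
Qed.

Lemma measurable_integral_itv01 (b : T -> R -> \bar R) :
  measurable_fun [set: T * line] (fun p => b p.1 p.2) -> (forall w s, 0 <= b w s) ->
  measurable_fun [set: T] (fun w => \int[leb]_(t in `[0%R, 1%R]) b w t).
Proof.
move=> mb b0.
pose b1 (p : T * line) := ((fun p : T * line => b p.1 p.2) \_ (setT `*` `[0%R, 1%R])) p.
have mb1 : measurable_fun [set: T * line] b1.
  apply/(measurable_restrict _ _ _) => //; first exact: measurableX.
  exact: measurable_funTS.
have b10 p : 0 <= b1 p by rewrite /b1 patchE; case: ifP.
rewrite (_ : (fun _ => _) = fubini_F leb b1).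
  exact: measurable_fun_fubini_tonelli_F.
apply/funext => w; rewrite [LHS]integral_mkcond; apply: eq_integral => t _.
rewrite /b1 !patchE (_ : ((w, t) \in _) = (t \in `[0%R, 1%R]%classic))//.
by apply/idP/idP => [/set_mem[_ /mem_set]|/set_mem t01]//; apply/mem_set; split.
Qed.

Variables (a b : T -> R -> \bar R).
Hypothesis ma : measurable_fun [set: T * line] (fun p => a p.1 p.2).
Hypothesis mb : measurable_fun [set: T * line] (fun p => b p.1 p.2).
Hypotheses (a0 : forall w s, 0 <= a w s) (b0 : forall w s, 0 <= b w s).

(** Tonelli twice: for fixed w, the variables s and t separate. *)
Lemma integral_square_mixture :
  \int[leb \x leb]_(z in `[0%R, 1%R] `*` `[0%R, 1%R])
    \int[P]_w (a w z.1 * b w z.2) =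
  \int[P]_w ((\int[leb]_(s in `[0%R, 1%R]) a w s) *
             (\int[leb]_(t in `[0%R, 1%R]) b w t)).
Proof.
have mab : measurable_fun [set: (line * line) * T]
    (fun p => a p.2 p.1.1 * b p.2 p.1.2).
  apply: emeasurable_funM.
    apply: (measurableT_comp (f := fun p : T * line => a p.1 p.2)
      (g := fun p : (line * line) * T => (p.2, p.1.1))) => //.
    apply: measurable_fun_pair => //.
    exact: measurableT_comp.
  apply: (measurableT_comp (f := fun p : T * line => b p.1 p.2)
      (g := fun p : (line * line) * T => (p.2, p.1.2))) => //.
  apply: measurable_fun_pair => //.
  exact: measurableT_comp.
have mas s : measurable_fun [set: T] (fun w => a w s).
  exact: (measurable_fun_pair1 s ma).
have maw w : measurable_fun [set: line] (a w).
  exact: (measurable_fun_pair2 w ma).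
have mbw w : measurable_fun [set: line] (b w).
  exact: (measurable_fun_pair2 w mb).
have mbi := measurable_integral_itv01 mb b0.
rewrite (@integral_setX _ _ _ _ _ _ _ _ _ (fun z : line * line =>
  \int[P]_w (a w z.1 * b w z.2)))//; last 2 first.
- apply: (@measurable_fun_fubini_tonelli_F _ _ _ _ _ P
    (fun p : (line * line) * T => a p.2 p.1.1 * b p.2 p.1.2)) => //.
  by move=> p; exact: mule_ge0.
- by move=> p; apply: integral_ge0 => w _; exact: mule_ge0.
transitivity (\int[leb]_(s in `[0%R, 1%R]) \int[P]_w
    (a w s * (\int[leb]_(t in `[0%R, 1%R]) b w t))).
  apply: eq_integral => s _ /=.
  rewrite (@exchange_integral_on _ _ _ _ _ leb P _ _
    (fun p : line * T => a p.2 s * b p.2 p.1))//=.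
  - apply: eq_integral => w _; rewrite ge0_integralZl//.
    exact: measurable_funTS.
  - apply: emeasurable_funM.
      exact: (measurableT_comp (mas s) measurable_snd).
    apply: (measurableT_comp (f := fun p : T * line => b p.1 p.2)
      (g := fun p : line * T => (p.2, p.1))) => //; exact: measurable_swap.
  - by move=> p; exact: mule_ge0.
rewrite (@exchange_integral_on _ _ _ _ _ leb P _ _ (fun p : line * T =>
  a p.2 p.1 * (\int[leb]_(t in `[0%R, 1%R]) b p.2 t)))//=.
- apply: eq_integral => w _; rewrite ge0_integralZr//.
    exact: measurable_funTS.
  by apply: integral_ge0 => t _.
- apply: emeasurable_funM.
    apply: (measurableT_comp (f := fun p : T * line => a p.1 p.2)
      (g := fun p : line * T => (p.2, p.1))) => //; exact: measurable_swap.
  exact: (measurableT_comp mbi measurable_snd).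
- by move=> p; apply: mule_ge0 => //; exact: integral_ge0.
Qed.

End mixture_of_products.

Section spearman.
Context {R : realType} d (T : measurableType d) (P : probability T R).
Local Notation leb := (@lebesgue_measure R).
Local Notation line := (measurableTypeR R).

(** Used with indicator functions for the law of an arbitrary copula, and with
    conditional distribution functions for psi(A). *)
Lemma spearman_rho_mixture (C : 2.-tuple R -> R) (a b : T -> R -> \bar R) :
  measurable_fun [set: T * line] (fun p => a p.1 p.2) ->
  measurable_fun [set: T * line] (fun p => b p.1 p.2) ->
  (forall w s, 0 <= a w s)%E -> (forall w s, 0 <= b w s)%E ->
  (forall s t : R, (0 <= s <= 1)%R -> (0 <= t <= 1)%R ->
    (C [tuple s; t]%R)%:E = \int[P]_w (a w s * b w t)%E)%E ->
  spearman_rho C = 12 * fine (\int[P]_w ((\int[leb]_(s in `[0%R, 1%R]) a w s) *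
    (\int[leb]_(t in `[0%R, 1%R]) b w t)))%E - 3.
Proof.
move=> ma mb a0 b0 CE; congr (12 * fine _ - 3).
rewrite -integral_square_mixture//; apply: eq_integral => -[s t] /set_mem[/=].
by rewrite !in_itv/= => s01 t01; exact: CE.
Qed.

End spearman.

Section spearman_copula.
Context {R : realType}.
Local Notation leb := (@lebesgue_measure R).
Local Notation line := (measurableTypeR R).

Lemma ord2_cases (i : 'I_2) : i = ord0 \/ i = ord_max.
Proof.
by case: i => -[|[|//]] i2; [left|right]; exact: val_inj.
Qed.

Lemma lower_orthant2 (s t : R) :
  lower_orthant [tuple s; t] =
  [set x : 2.-tuple R | tnth x ord0 <= s /\ tnth x ord_max <= t].
Proof.
rewrite eqEsubset; split=> x /=.
  by move=> xst; split; [exact: (xst ord0)|exact: (xst ord_max)].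
by move=> [x0 x1] i; have [->|->] := ord2_cases i.
Qed.

Lemma copula_measure_law (k : nat) (C : k.-tuple R -> R) :
  copula C -> copula_law C (copula_measure C).
Proof. by move=> [mu Cmu]; apply: (@getPex _ [set mu | copula_law C mu]); exists mu. Qed.

Lemma integral_cube_coord (k : nat) (C : k.-tuple R -> R)
    (mu : probability (k.-tuple R) R) (i : 'I_k) :
  copula_law C mu -> \int[mu]_(x in @cube R k) tnth x i = 2^-1.
Proof.
move=> Cmu.
have -> := @integral_uniform_law _ _ _ mu (@cube R k) (fun x => tnth x i) id
  (@measurable_cube R k) (copula_law_cube Cmu) (fun x xc => xc i)
  (measurable_tnth i) (Cmu.1 i) (@measurable_id _ _ _)
  (fun x x01 => proj1 (andP x01)).
transitivity (fine (\int[leb]_(x in `[0%R, 1%R]) (x ^+ 1)%:E)); first by [].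
by rewrite integral_itv01_exprn.
Qed.

(** Fubini gives 12 E[(1 - S)(1 - T)] - 3 for (S, T) distributed as the copula,
    and both margins have mean one half. *)
Lemma spearman_rho_product_moment (C : 2.-tuple R -> R) : copula C ->
  spearman_rho C = 12 * (\int[copula_measure C]_(z in @cube R 2)
                           (tnth z ord0 * tnth z ord_max)) - 3.
Proof.
move=> /copula_measure_law; set mu := copula_measure C => Cmu.
pose step (i : 'I_2) (x : 2.-tuple R) (s : R) : \bar R := ((tnth x i <= s)%R%:R)%:E.
have mstep i : measurable_fun [set: 2.-tuple R * line] (fun p => step i p.1 p.2).
  exact: (measurable_step (measurable_tnth i)).
have step0 i x s : (0 <= step i x s)%E by rewrite lee_fin.
have mcube : measurable (@cube R 2) by exact: measurable_cube.
rewrite (spearman_rho_mixture (P := mu) (a := step ord0)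
  (b := step ord_max))//; last first.
  move=> s t s01 t01; rewrite -Cmu.2; last first.
    by move=> i; have [->|->] := ord2_cases i; rewrite in_itv.
  transitivity (\int[mu]_x (\1_(lower_orthant [tuple s; t]) x)%:E)%E.
    by rewrite integral_indic ?setIT//; exact: measurable_lower_orthant.
  apply: eq_integral => x _; rewrite indicE lower_orthant2 /step -EFinM -natrM mulnb.
  rewrite (_ : (x \in _) = (tnth x ord0 <= s) && (tnth x ord_max <= t))//.
  by apply/idP/idP => [/set_mem[/= -> ->//]|/andP[x0 x1]]; exact/mem_set.
congr (12 * _ - 3).
rewrite -(ge0_integral_conull mcube (copula_law_cube Cmu)); last 2 first.
- by apply: emeasurable_funM; exact: measurable_integral_itv01.
- by move=> x; rewrite mule_ge0// integral_ge0.
transitivity (\int[mu]_(x in @cube R 2) ((1 - tnth x ord0) * (1 - tnth x ord_max))).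
  congr fine; apply: eq_integral => x /set_mem xc.
  by rewrite /step !integral_itv01_step//;
    have := xc ord0; have := xc ord_max; rewrite !in_itv/=.
have mt i : measurable_fun (@cube R 2) (fun x : 2.-tuple R => tnth x i).
  by apply: measurable_funTS; exact: (measurable_tnth i).
have int1 i : mu.-integrable (@cube R 2) (EFin \o (fun x => tnth x i)).
  apply: (@bounded_integrable _ _ _ mu _ _ 1) => // x xc.
  by have := xc i; rewrite in_itv/= => /andP[x0 x1]; rewrite ger0_norm.
have int2 : mu.-integrable (@cube R 2) (EFin \o (fun x => tnth x ord0 * tnth x ord_max)).
  apply: (@bounded_integrable _ _ _ mu _ _ 1) => //; first exact: measurable_funM.
  move=> x xc.
  have := xc ord0; rewrite in_itv/= => /andP[x0 x1].
  have := xc ord_max; rewrite in_itv/= => /andP[y0 y1].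
  by rewrite ger0_norm ?mulr_ge0// mulr_ile1.
have int0 : mu.-integrable (@cube R 2) (EFin \o (cst 1)).
  by apply: (@bounded_integrable _ _ _ mu _ _ 1) => // x _; rewrite normr1.
transitivity (\int[mu]_(x in @cube R 2) ((cst 1 x - tnth x ord0) +
   (tnth x ord0 * tnth x ord_max - tnth x ord_max))).
  by apply: eq_Rintegral => x _ /=; ring.
rewrite RintegralD//; last 2 first.
- exact: (integrableB mcube int0 (int1 ord0)).
- exact: (integrableB mcube int2 (int1 ord_max)).
have int0E : \int[mu]_(x in @cube R 2) cst 1 x = 1.
  by rewrite Rintegral_cst// mul1r; exact: (congr1 fine (copula_law_cube Cmu)).
rewrite !RintegralB// !(integral_cube_coord _ Cmu) int0E; lra.
Qed.

End spearman_copula.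

(** * Conditional expectation and variance *)

Section conditional_expectation.
Context {R : realType} d (T : measurableType d) (P : probability T R).

Lemma fine_variance (X : T -> R) (M : R) :
  measurable_fun [set: T] X -> (forall w, `|X w| <= M) ->
  fine ('V_P[X])%E = \int[P]_w (X w ^+ 2) - (\int[P]_w X w) ^+ 2.
Proof.
move=> mX XM; set m := \int[P]_w X w.
have intX : P.-integrable setT (EFin \o X).
  by apply: (@bounded_integrable _ _ _ P _ _ M).
have intX2 : P.-integrable setT (EFin \o (fun w => X w ^+ 2)).
  apply: (@bounded_integrable _ _ _ P _ _ (M ^+ 2)) => //; first exact: measurable_funX.
  by move=> w _; rewrite normrX ler_sqr ?nnegrE// (le_trans _ (XM w)).
have int1 (c : R) : P.-integrable setT (EFin \o (cst c)).
  by apply: (@bounded_integrable _ _ _ P _ _ `|c|).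
have intmX : P.-integrable setT (EFin \o (fun w => (2 * m) * X w)).
  exact: (integrableZl measurableT (2 * m) intX).
rewrite /variance covariance.unlock !expectation.unlock.
rewrite -[fine (\int[P]_w (X w)%:E)%E]/m.
transitivity (\int[P]_w ((X w ^+ 2 - (2 * m) * X w) + cst (m ^+ 2) w)).
  by apply: eq_Rintegral => w _; rewrite !fctE/=; ring.
rewrite RintegralD//; last exact: (integrableB measurableT intX2 intmX).
rewrite RintegralB// RintegralZl// -/m Rintegral_cst//.
have -> : fine (P [set: T]) = 1 by rewrite probability_setT.
ring.
Qed.

Lemma variance_ae_eq (X Y : T -> R) :
  measurable_fun [set: T] X -> measurable_fun [set: T] Y ->
  ae_eq P setT X Y -> ('V_P[X] = 'V_P[Y])%E.
Proof.
move=> mX mY XY.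
have EXY : \int[P]_w X w = \int[P]_w Y w.
  congr fine; apply: ae_eq_integral => //; try exact/measurable_EFinP.
  by apply: filterS XY => w /= /(_ I) ->.
rewrite /variance covariance.unlock !expectation.unlock.
rewrite -!/(Rintegral P _ _) EXY.
apply: ae_eq_integral => //=.
- by apply/measurable_EFinP; apply: measurable_funM; apply: measurable_funB.
- by apply/measurable_EFinP; apply: measurable_funM; apply: measurable_funB.
- by apply: filterS XY => w /= /(_ I); rewrite !fctE/= => ->.
Qed.

Context d' (T' : measurableType d') (W : {mfun T >-> T'}) (Z : T -> R).

(** Push the probability forward to the sigma-algebra generated by W; there both
    versions are measurable and have the same integral over every event. *)
Lemma cond_expectation_unique (H1 H2 : T -> R) :
  is_cond_expectation P Z W H1 -> is_cond_expectation P Z W H2 ->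
  ae_eq P setT H1 H2.
Proof.
move=> [i1 m1 e1] [i2 m2 e2].
pose S := g_sigma_algebra_preimageType W.
have mid : measurable_fun [set: T] (id : T -> S).
  by move=> _ A [B mB <-]; rewrite setTI; exact: measurable_funPT.
pose idS : {mfun T >-> S} := HB.pack (id : T -> S) (isMeasurableFun.Build _ _ _ _ _ mid).
pose Q : {measure set S -> \bar R} := distribution P idS.
have mH (H : T -> R) : (forall B : set R, measurable B ->
    preimage_set_system setT W measurable (H @^-1` B)) ->
    measurable_fun [set: S] (EFin \o H).
  by move=> mH; apply/measurable_EFinP => _ B mB; rewrite setTI; exact: mH.
have intS (H : T -> R) E : P.-integrable setT (EFin \o H) ->
    measurable_fun [set: S] (EFin \o H) -> measurable E ->
    (\int[Q]_(w in E) (H w)%:E = \int[P]_(w in E) (H w)%:E)%E.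
  move=> iH mHS mE; rewrite integral_pushforward//.
  by apply: integrableS iH => //; rewrite -[X in measurable X]setTI;
    exact: (mid measurableT).
have /= : ae_eq Q [set: S] (EFin \o H1) (EFin \o H2).
  apply: (@integral_ae_eq _ _ _ Q [set: S]) => //.
  - by apply: integrable_pushforward => //; exact: mH.
  - exact: mH.
  - move=> E _ mE; rewrite /= !intS//; [|exact: mH..].
    by have [B mB <-] := mE; rewrite setTI e1// e2.
move=> [N [mN N0 subN]].
exists N; split => //.
  by rewrite -[X in measurable X]setTI; exact: (mid measurableT).
by move=> w /= H12; apply: subN => /= H12'; apply: H12 => _; have [] := H12' I.
Qed.

(** Versions agree almost surely, and the chosen function is a version as soon as
    one exists. *)
Lemma variance_cond_expectation (H : T -> R) :
  is_cond_expectation P Z W H -> ('V_P[cond_expectation P Z W] = 'V_P[H])%E.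
Proof.
move=> HZ.
have CZ : is_cond_expectation P Z W (cond_expectation P Z W).
  exact: (@xgetPex _ (cst 0) [set H | is_cond_expectation P Z W H] (ex_intro _ H HZ)).
apply: variance_ae_eq; last exact: cond_expectation_unique.
- by apply/measurable_EFinP; have [/measurable_int] := CZ.
- by apply/measurable_EFinP; have [/measurable_int] := HZ.
Qed.

End conditional_expectation.

(** * Conditional expectation from a kernel *)

Section kernel_fst.
Context {R : realType} d1 d2 d3 (T1 : measurableType d1) (T2 : measurableType d2)
  (T3 : measurableType d3) (K : R.-pker T1 ~> T3).

(** Turns [K] into a kernel on a product, as required both for the measurability
    of parametrized sections and for the product of [K] with itself. *)
Definition kernel_fst : T1 * T2 -> {measure set T3 -> \bar R} := K \o fst.

Let measurable_kernel_fst U : measurable U ->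
  measurable_fun [set: T1 * T2] (kernel_fst ^~ U).
Proof.
by move=> mU; apply: (measurableT_comp (f := K ^~ U)) => //; exact: measurable_kernel.
Qed.

HB.instance Definition _ := @isKernel.Build _ _ _ _ _ kernel_fst measurable_kernel_fst.

Let kernel_fst1 p : kernel_fst p setT = 1%E.
Proof. exact: prob_kernel. Qed.

HB.instance Definition _ := @Kernel_isProbability.Build _ _ _ _ _ kernel_fst kernel_fst1.

End kernel_fst.
Arguments kernel_fst {R d1 d2 d3 T1} T2 {T3} K.

Section kernel_cdf.
Local Open Scope ereal_scope.
Context {R : realType} d (Om : measurableType d) (K : R.-pker Om ~> R).
Local Notation leb := (@lebesgue_measure R).
Local Notation line := (measurableTypeR R).

(** [K u [0, s]] is the [K u]-measure of the section at (u, s) of the measurable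
    set of all ((u, s), v) with 0 <= v <= s. *)
Lemma measurable_kernel_cdf :
  measurable_fun [set: Om * line] (fun p => K p.1 `[0%R, p.2]%classic).
Proof.
pose A := [set q : (Om * line) * R | (0 <= q.2)%R && (q.2 <= q.1.2)%R].
have mA : measurable A.
  rewrite (_ : A = [set q | (0 <= q.2)%R] `&` [set q | (q.2 <= q.1.2)%R]); last first.
    by rewrite eqEsubset; split=> q /andP.
  apply: measurableI.
    rewrite -[X in measurable X]setTI.
    by apply: (measurable_fun_ler (f := cst 0%R) (g := snd)).
  rewrite -[X in measurable X]setTI.
  apply: (measurable_fun_ler (f := snd) (g := fun q : (Om * line) * R => q.1.2)) => //.
  exact: measurableT_comp.
have := measurable_fun_xsection_finite_kernel (kernel_fst line K) (mem_set mA).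
congr measurable_fun; apply/funext => -[u s] /=; rewrite /kernel_fst/=.
congr (K u _); rewrite eqEsubset; split=> v /=.
  by rewrite /xsection/= => /set_mem; rewrite in_itv.
by rewrite in_itv/= => vs; exact/mem_set.
Qed.

Lemma kernel_cdf_le1 u s : K u `[0%R, s]%classic <= 1.
Proof. by rewrite -(@prob_kernel _ _ _ _ _ K u) le_measure ?inE. Qed.

(** When [K u] is carried by the unit interval, this is the mean of 1 - v for v
    distributed as [K u]. *)
Definition kernel_cdf_area (u : Om) : \bar R :=
  \int[leb]_(s in `[0%R, 1%R]) K u `[0%R, s]%classic.

Lemma measurable_kernel_cdf_area : measurable_fun [set: Om] kernel_cdf_area.
Proof. exact: (measurable_integral_itv01 measurable_kernel_cdf). Qed.

Lemma kernel_cdf_area_ge0 u : 0 <= kernel_cdf_area u.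
Proof. by apply: integral_ge0 => s _. Qed.

Lemma kernel_cdf_area_le1 u : kernel_cdf_area u <= 1.
Proof.
apply: (@le_trans _ _ (\int[leb]_(s in `[0%R, 1%R]) (cst 1 s))).
  apply: ge0_le_integral => //.
    apply: measurable_funTS.
    exact: (measurable_fun_pair2 u measurable_kernel_cdf).
  by move=> s _; exact: kernel_cdf_le1.
by rewrite integral_cst//= lebesgue_measure_itv/= lte_fin ltr01 mul1e sube0.
Qed.

Lemma kernel_cdf_area_fineK u : (fine (kernel_cdf_area u))%:E = kernel_cdf_area u.
Proof.
rewrite fineK// ge0_fin_numE ?kernel_cdf_area_ge0//.
by rewrite (le_lt_trans (kernel_cdf_area_le1 u)) ?ltry.
Qed.

(** Defined from the area, hence between 0 and 1 even for the exceptional [u] at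
    which [K u] is not carried by the unit interval. *)
Definition kernel_mean (u : Om) : R := (1 - fine (kernel_cdf_area u))%R.

Lemma kernel_mean_itv01 u : (0 <= kernel_mean u <= 1)%R.
Proof.
rewrite /kernel_mean subr_ge0 lerBlDr lerDl -!lee_fin kernel_cdf_area_fineK.
by rewrite kernel_cdf_area_le1 kernel_cdf_area_ge0.
Qed.

Lemma measurable_kernel_mean : measurable_fun [set: Om] kernel_mean.
Proof.
apply: measurable_funB => //; apply/measurable_EFinP.
rewrite (_ : _ \o _ = kernel_cdf_area); first exact: measurable_kernel_cdf_area.
by apply/funext => u /=; rewrite kernel_cdf_area_fineK.
Qed.

End kernel_cdf.

Section disintegration.
Context {R : realType} d (T : measurableType d) (P : probability T R).
Context d' (Om : measurableType d') (U : {mfun T >-> Om}) (V : T -> R).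
Context (K : R.-pker Om ~> R).
Local Notation leb := (@lebesgue_measure R).
Local Notation line := (measurableTypeR R).
Hypothesis mV : measurable_fun [set: T] V.
Hypothesis V01 : forall w, 0 <= V w <= 1.
Hypothesis disintegration : forall E F, measurable E -> measurable F ->
  P (U @^-1` E `&` V @^-1` F) = (\int[P]_(w in U @^-1` E) K (U w) F)%E.

Let mUE E : measurable E -> measurable (U @^-1` E).
Proof. by move=> mE; rewrite -[X in measurable X]setTI; exact: measurable_funPT. Qed.

Lemma measurable_kernel_cdf_comp :
  measurable_fun [set: T * line] (fun p => K (U p.1) `[0%R, p.2]%classic).
Proof.
apply: (measurableT_comp (f := fun q : Om * line => K q.1 `[0%R, q.2]%classic)
  (g := fun p : T * line => (U p.1, p.2))); first exact: measurable_kernel_cdf.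
apply: measurable_fun_pair => //; exact: measurableT_comp.
Qed.

(** Both sides are integrals over s in [0, 1]: on the left of P(U in E, V <= s) by
    disintegration, on the right because 1 - V is the length of [V, 1]. *)
Lemma integral_kernel_cdf_area (E : set Om) : measurable E ->
  (\int[P]_(w in U @^-1` E) kernel_cdf_area K (U w) =
   \int[P]_(w in U @^-1` E) (1 - V w)%:E)%E.
Proof.
move=> mE; rewrite /kernel_cdf_area.
rewrite (@exchange_integral_on _ _ _ _ _ P leb _ _
  (fun p : T * line => K (U p.1) `[0%R, p.2]%classic))//=; last 2 first.
- exact: mUE.
- exact: measurable_kernel_cdf_comp.
transitivity (\int[leb]_(s in `[0%R, 1%R]) \int[P]_(w in U @^-1` E)
    ((V w <= s)%R%:R)%:E)%E.
  apply: eq_integral => s _; rewrite -disintegration//.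
  transitivity (\int[P]_(w in U @^-1` E) (\1_(V @^-1` `[0%R, s]%classic) w)%:E)%E.
    have mVs : measurable (V @^-1` `[0%R, s]%classic).
      by rewrite -[X in measurable X]setTI; exact: mV.
    by rewrite (integral_indic P (mUE mE) mVs) setIC.
  apply: eq_integral => w _; rewrite indicE (_ : (w \in _) = (V w <= s)%R)//.
  have /andP[V0 _] := V01 w.
  apply/idP/idP => [/set_mem/=|Vs]; first by rewrite in_itv/= V0.
  by apply/mem_set; rewrite /= in_itv/= V0.
rewrite -(@exchange_integral_on _ _ _ _ _ P leb _ _
  (fun p : T * line => ((V p.1 <= p.2)%R%:R)%:E) (mUE mE) (measurable_itv _)
  (measurable_step mV))//=.
by apply: eq_integral => w _; rewrite integral_itv01_step.
Qed.

Lemma kernel_mean_is_cond_expectation :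
  is_cond_expectation P V U (kernel_mean K \o U).
Proof.
have mH : measurable_fun [set: T] (kernel_mean K \o U).
  by apply: measurableT_comp => //; exact: measurable_kernel_mean.
have norm1 (x : R) : 0 <= x <= 1 -> `|x| <= 1.
  by move=> /andP[x0 x1]; rewrite ger0_norm.
split.
- apply: (@bounded_integrable _ _ _ P _ _ 1) => // w _ /=.
  exact/norm1/kernel_mean_itv01.
- move=> B mB; exists (kernel_mean K @^-1` B).
    by rewrite -[X in measurable X]setTI; exact: measurable_kernel_mean.
  by rewrite setTI.
- move=> B mB; set D := U @^-1` B.
  have mD : measurable D by exact: mUE.
  have intD (f : T -> R) : measurable_fun [set: T] f -> (forall w, 0 <= f w <= 1) ->
      P.-integrable D (EFin \o f).
    move=> mf f01; apply: (@bounded_integrable _ _ _ P _ _ 1) => //.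
      exact: measurable_funTS.
    by move=> w _; exact/norm1.
  have area01 u : 0 <= fine (kernel_cdf_area K u) <= 1.
    have := kernel_mean_itv01 K u; rewrite /kernel_mean; lra.
  have marea : measurable_fun [set: T] (fun w => fine (kernel_cdf_area K (U w))).
    rewrite (_ : (fun _ => _) = (fun w => 1 - (kernel_mean K \o U) w)).
      exact: measurable_funB.
    by apply/funext => w; rewrite /kernel_mean/=; lra.
  have int1 : P.-integrable D (EFin \o cst 1).
    by apply: intD => // w /=; rewrite ler01 lexx.
  have intarea := intD _ marea (fun w => area01 (U w)).
  have intV := intD _ mV V01.
  have V1 w : 0 <= 1 - V w <= 1 by have := V01 w; lra.
  have int1V : P.-integrable D (EFin \o (fun w => 1 - V w)).
    by apply: intD => //; exact: measurable_funB.
  transitivity (\int[P]_(w in D) (cst 1 w - fine (kernel_cdf_area K (U w)))%:E)%E.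
    by [].
  rewrite integralB_EFin// [X in (_ - X)%E](_ : _ =
      \int[P]_(w in D) (1 - V w)%:E)%E; last first.
    rewrite -integral_kernel_cdf_area//; apply: eq_integral => w _ /=.
    by rewrite kernel_cdf_area_fineK.
  rewrite -integralB_EFin//; apply: eq_integral => w _ /=.
  by congr EFin; lra.
Qed.

End disintegration.

(** * The law of two conditionally independent copies *)

Section kernel_mixture.
Local Open Scope ereal_scope.
Context {R : realType} d d' (S : measurableType d) (S' : measurableType d').
Context (mu : {measure set S -> \bar R}) (k : R.-ker S ~> S').

Definition kernel_mixture (A : set S') : \bar R := \int[mu]_x k x A.

Let kernel_mixture0 : kernel_mixture set0 = 0.
Proof. by apply: integral0_eq => x _; rewrite measure0. Qed.

Let kernel_mixture_ge0 A : 0 <= kernel_mixture A.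
Proof. exact: integral_ge0. Qed.

Let kernel_mixture_sigma_additive : semi_sigma_additive kernel_mixture.
Proof.
move=> F mF tF mUF; rewrite [X in _ --> X](_ : _ =
    \int[mu]_x (\sum_(n <oo) k x (F n))); last first.
  apply: eq_integral => x _.
  by apply/esym/cvg_lim => //; exact/measure_semi_sigma_additive.
apply/cvg_closeP; split.
  by apply: is_cvg_nneseries => n _ _; exact: integral_ge0.
by rewrite closeE// integral_nneseries// => n; exact: measurable_kernel.
Qed.

HB.instance Definition _ := isMeasure.Build _ _ _ kernel_mixture
  kernel_mixture0 kernel_mixture_ge0 kernel_mixture_sigma_additive.

End kernel_mixture.

Section conditional_copies.
Context {R : realType} d (Om : measurableType d) (mu : probability Om R).
Context (K : R.-pker Om ~> R).

Definition pair_tuple (p : R * R) : 2.-tuple R := [tuple p.1; p.2].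

Lemma measurable_pair_tuple : measurable_fun [set: R * R] pair_tuple.
Proof.
apply/measurable_fun_tnthP => i; have [->|->] := ord2_cases i.
  by rewrite (_ : _ \o _ = fst).
by rewrite (_ : _ \o _ = snd).
Qed.

HB.instance Definition _ := isMeasurableFun.Build _ _ _ _
  pair_tuple measurable_pair_tuple.

Lemma kproduct_rectangle u (A B : set R) : measurable A -> measurable B ->
  kproduct K (kernel_fst R K) u (A `*` B) = (K u A * K u B)%E.
Proof.
move=> mA mB.
transitivity (\int[K u]_y ((\1_A y)%:E * K u B))%E.
  apply: eq_integral => y _.
  transitivity (\int[K u]_z ((\1_A y)%:E * (\1_B z)%:E))%E.
    apply: eq_integral => z _; rewrite -EFinM !indicE -natrM mulnb.
    rewrite (_ : ((y, z) \in _) = (y \in A) && (z \in B))//.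
    by apply/idP/andP => [/set_mem[/= yA zB]|[/set_mem yA /set_mem zB]];
      [split; exact: mem_set|apply/mem_set].
  rewrite ge0_integralZl//; last by apply/measurable_EFinP; exact: measurable_indic.
  by rewrite integral_indic// setIT.
rewrite ge0_integralZr//; last by apply/measurable_EFinP; exact: measurable_indic.
by rewrite integral_indic// setIT.
Qed.

(** The law of a pair which, given a parameter drawn from [mu], consists of two
    independent draws from the kernel. *)
Lemma conditional_copies : exists nu : probability (2.-tuple R) R,
  forall A B, measurable A -> measurable B ->
    nu [set x | A (tnth x ord0) /\ B (tnth x ord_max)] =
    (\int[mu]_u (K u A * K u B))%E.
Proof.
pose m : {measure set (R * R) -> \bar R} :=
  kernel_mixture mu (mkproduct K (kernel_fst R K)).
have mE A B : measurable A -> measurable B ->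
    m (A `*` B) = (\int[mu]_u (K u A * K u B))%E.
  by move=> mA mB; apply: eq_integral => u _; rewrite -kproduct_rectangle.
have m1 : m setT = 1%E.
  rewrite -setXTT mE// (eq_integral (cst 1%E)); last first.
    by move=> u _; rewrite prob_kernel mule1.
  by rewrite integral_cst// mul1e; exact: (probability_setT mu).
pose pm : probability (R * R)%type R :=
  HB.pack (kernel_mixture mu (mkproduct K (kernel_fst R K)))
    (Measure_isProbability.Build _ _ _
      (kernel_mixture mu (mkproduct K (kernel_fst R K))) m1).
exists (distribution pm pair_tuple) => A B mA mB.
by rewrite -mE.
Qed.

End conditional_copies.

(** * The copula psi(A) and the coefficient of determination *)

Section psi.
Context dT (T : measurableType dT) (R : realType) (P : probability T R) (n : nat).
Context (X : 'I_n -> {RV P >-> R}) (Y : {RV P >-> R}).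
Hypothesis contX : forall i, continuous (cdf (X i)).
Hypothesis contY : continuous (cdf Y).
Context (K : R.-pker (n.-tuple R) ~> R).
Local Notation A := (connecting_copula X Y).
Local Notation U := (pit_vector X).
Hypothesis hK : markov_kernel_of A K.
Local Notation unif := (uniform_prob (@ltr01 R)).
Local Notation leb := (@lebesgue_measure R).
Local Notation line := (measurableTypeR R).

Let disint := markov_kernel_pit contX contY hK.

Let measurable_K B : measurable B -> measurable_fun [set: n.-tuple R] (K ^~ B).
Proof. exact: measurable_kernel. Qed.

(** The initial marginal of the copula is the law of U, which is carried by the
    cube. *)
Lemma psiE (s t : R) :
  (psi A K [tuple s; t])%:E =
  (\int[distribution P U]_u (K u `[0%R, s]%classic * K u `[0%R, t]%classic))%E.
Proof.
set mu := distribution P U.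
have Kfin u r : (fine (K u `[0%R, r]%classic))%:E = K u `[0%R, r]%classic.
  by rewrite fineK// ge0_fin_numE// (le_lt_trans (kernel_cdf_le1 K u r)) ?ltry.
have mKK : measurable_fun [set: n.-tuple R]
    (fun u => K u `[0%R, s]%classic * K u `[0%R, t]%classic)%E.
  by apply: emeasurable_funM; exact: measurable_K.
transitivity (\int[mu]_(u in @cube R n)
    (K u `[0%R, s]%classic * K u `[0%R, t]%classic))%E;
    last first.
  apply: (ge0_integral_conull (@measurable_cube R n)
    (copula_law_cube (init_marginal_law Y contX)) mKK).
  by move=> u; exact: mule_ge0.
rewrite /psi /Rintegral.
rewrite (@eq_measure_integral _ _ _ _ mu); last first.
  by move=> B mB _; exact: (copula_measureE (init_marginal_law Y contX)).
under eq_integral do rewrite EFinM !Kfin.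
rewrite fineK// ge0_fin_numE; last by apply: integral_ge0 => u _; exact: mule_ge0.
apply: (@le_lt_trans _ _ (\int[mu]_(u in @cube R n) cst 1 u)%E).
  apply: ge0_le_integral => //.
  - exact: measurable_cube.
  - exact: measurable_funTS.
  - move=> u _; rewrite -[leRHS]mule1.
    by apply: lee_pmul => //; exact: kernel_cdf_le1.
rewrite integral_cst//=; last exact: measurable_cube.
by rewrite mul1e (le_lt_trans (probability_le1 _ _)) ?ltry//; exact: measurable_cube.
Qed.

Lemma kernel_marginal (B : set R) : measurable B ->
  (\int[distribution P U]_u K u B = unif B)%E.
Proof.
move=> mB; rewrite -(probability_pit contY mB).
rewrite ge0_integral_distribution//; last exact: measurable_K.
by have := disint measurableT mB; rewrite preimage_setT setTI => ->.
Qed.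

(** psi is defined with intervals [0, s] rather than rays; on the cube, which has
    full measure for the law of the two copies, a lower orthant is a product of
    such intervals. *)
Lemma copula_psi : copula (psi A K).
Proof.
have [nu nuE] := conditional_copies (distribution P U) K.
have nu0 B : measurable B -> nu [set x | B (tnth x ord0)] = unif B.
  move=> mB; rewrite (_ : [set x | _] =
    [set x : 2.-tuple R | B (tnth x ord0) /\ setT (tnth x ord_max)]); last first.
    by rewrite eqEsubset; split=> x /=; [|case].
  rewrite nuE// -(kernel_marginal mB); apply: eq_integral => u _.
  by rewrite prob_kernel mule1.
have nu1 B : measurable B -> nu [set x | B (tnth x ord_max)] = unif B.
  move=> mB; rewrite (_ : [set x | _] =
    [set x : 2.-tuple R | setT (tnth x ord0) /\ B (tnth x ord_max)]); last first.
    by rewrite eqEsubset; split=> x /=; [|case].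
  rewrite nuE// -(kernel_marginal mB); apply: eq_integral => u _.
  by rewrite prob_kernel mul1e.
have nu_unif (i : 'I_2) B : measurable B -> nu [set x | B (tnth x i)] = unif B.
  by have [->|->] := ord2_cases i; [exact: nu0|exact: nu1].
exists nu; split=> // u u01.
(* Full measure of the cube depends on the margins only, so the distribution
   function of nu itself serves as the copula here. *)
have nu_law : copula_law (fun u => fine (nu (lower_orthant u))) nu.
  by split=> // v _; rewrite fineK// fin_num_measure//; exact: measurable_lower_orthant.
have -> : u = [tuple tnth u ord0; tnth u ord_max].
  by apply: eq_from_tnth => i; have [->|->] := ord2_cases i.
rewrite psiE -nuE//.
rewrite -(probability_setI_conull (@measurable_cube R 2)
  (measurable_lower_orthant _) (copula_law_cube nu_law)).
congr (nu _); rewrite lower_orthant2 eqEsubset; split=> x /=.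
  move=> [[x0 x1] xc].
  have := xc ord0; have := xc ord_max; rewrite !in_itv/= x0 x1.
  by move=> /andP[-> _] /andP[-> _].
rewrite !in_itv/= => -[/andP[x0 x0s] /andP[x1 x1t]]; split => //.
have := u01 ord0; have := u01 ord_max; rewrite !in_itv/= => /andP[_ t1] /andP[_ s1].
move=> i; have [->|->] := ord2_cases i; rewrite in_itv/=.
  by rewrite x0 (le_trans x0s).
by rewrite x1 (le_trans x1t).
Qed.

Lemma integral_pit : \int[P]_w pit Y w = 2^-1.
Proof.
rewrite (@integral_uniform_law _ _ _ P setT (pit Y) id)//.
- transitivity (fine (\int[leb]_(x in `[0%R, 1%R]) (x ^+ 1)%:E)); first by [].
  by rewrite integral_itv01_exprn.
- exact: probability_setT.
- by move=> w _; exact: pit_itv01.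
- exact: measurable_pit.
- by move=> B mB; exact: probability_pit.
- by move=> x /andP[].
Qed.

Lemma integral_pit_sqr : \int[P]_w (pit Y w ^+ 2) = 3^-1.
Proof.
rewrite (@integral_uniform_law _ _ _ P setT (pit Y) (fun x => x ^+ 2))//.
- by rewrite /Rintegral integral_itv01_exprn.
- exact: probability_setT.
- by move=> w _; exact: pit_itv01.
- exact: measurable_pit.
- by move=> B mB; exact: probability_pit.
- by move=> x _; exact: sqr_ge0.
Qed.

Lemma R2_pit : R2 P (pit Y) U = spearman_rho (psi A K).
Proof.
have mh := kernel_mean_is_cond_expectation (U := U) (measurable_pit Y)
  (pit_itv01 Y) disint.
pose g w : R := fine (kernel_cdf_area K (U w)).
have g01 w : 0 <= g w <= 1.
  have := kernel_mean_itv01 K (U w); rewrite /kernel_mean -/(g w); lra.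
have norm1 (x : R) : 0 <= x <= 1 -> `|x| <= 1.
  by move=> /andP[x0 x1]; rewrite ger0_norm.
have mg : measurable_fun [set: T] g.
  rewrite (_ : g = (fun w => 1 - (kernel_mean K \o U) w)).
    apply: measurable_funB => //.
    by apply: measurableT_comp => //; exact: measurable_kernel_mean.
  by apply/funext => w; rewrite /kernel_mean/= -/(g w); lra.
have hE : kernel_mean K \o U = fun w => 1 - g w by [].
have intg : P.-integrable setT (EFin \o g).
  by apply: (@bounded_integrable _ _ _ P _ _ 1) => // w _; exact: norm1.
have intg2 : P.-integrable setT (EFin \o (fun w => g w ^+ 2)).
  apply: (@bounded_integrable _ _ _ P _ _ 1) => //; first exact: measurable_funX.
  by move=> w _; rewrite normrX exprn_ile1// norm1.
have int1 : P.-integrable setT (EFin \o cst (1 : R)).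
  by apply: (@bounded_integrable _ _ _ P _ _ 1) => // w _; rewrite normr1.
have int1E : \int[P]_w cst (1 : R) w = 1.
  by rewrite Rintegral_cst// mul1r; exact: (congr1 fine (probability_setT P)).
have Eh : \int[P]_w (1 - g w) = 2^-1.
  have [_ _ /(_ setT measurableT)] := mh; rewrite preimage_setT => hV.
  by rewrite -integral_pit; exact: (congr1 fine hV).
have Eg : \int[P]_w g w = 2^-1.
  have := RintegralB measurableT int1 intg.
  rewrite int1E [X in X = _](_ : _ = 2^-1)//; lra.
(* (1 - g)^2 = (1 - g) + (g^2 - g), and both g and 1 - g have mean 1/2. *)
have Eh2 : \int[P]_w ((1 - g w) ^+ 2) = \int[P]_w (g w ^+ 2).
  transitivity (\int[P]_w ((cst 1 w - g w) + (g w ^+ 2 - g w))).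
    by apply: eq_Rintegral => w _ /=; ring.
  rewrite RintegralD//; last 2 first.
  - exact: (integrableB measurableT int1 intg).
  - exact: (integrableB measurableT intg2 intg).
  by rewrite !RintegralB// int1E Eg; lra.
rewrite /R2 (variance_cond_expectation mh).
rewrite (fine_variance P (M := 1) (measurable_pit Y)); last first.
  by move=> w; exact/norm1/pit_itv01.
rewrite hE (fine_variance P (M := 1)); last 2 first.
- exact: measurable_funB.
- by move=> w; apply: norm1; have := g01 w; lra.
rewrite integral_pit integral_pit_sqr Eh Eh2.
have mK := measurable_kernel_cdf_comp U K.
have K0 w s : (0 <= K (U w) `[0%R, s]%classic)%E by [].
rewrite (spearman_rho_mixture (P := P) mK mK K0 K0) => [|s t _ _]; last first.
  rewrite psiE ge0_integral_distribution//.
  by apply: emeasurable_funM; exact: measurable_K.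
rewrite [X in fine X](_ : _ = \int[P]_w (g w ^+ 2)%:E)%E; last first.
  apply: eq_integral => w _.
  by rewrite -/(kernel_cdf_area K (U w)) -kernel_cdf_area_fineK.
rewrite -/(Rintegral P setT (fun w => g w ^+ 2)).
set I := Rintegral _ _ _.
by field.
Qed.

End psi.

Theorem corollary5 (dT : measure_display) (T : measurableType dT) (R : realType)
    (P : probability T R) (d : nat) (d_ge1 : (1 <= d)%N)
    (X : 'I_d -> {RV P >-> R}) (Y : {RV P >-> R})
    (contX : forall i, continuous (cdf (X i))) (contY : continuous (cdf Y))
    (K : R.-pker (d.-tuple R) ~> R)
    (hK : markov_kernel_of (connecting_copula X Y) K) :
  [/\ copula (psi (connecting_copula X Y) K),
      R2 P (pit Y) (pit_vector X) =
        spearman_rho (psi (connecting_copula X Y) K) &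
      forall C : 2.-tuple R -> R, copula C ->
        spearman_rho C =
        12 * (\int[copula_measure C]_(z in @cube R 2)
                (tnth z ord0 * tnth z ord_max)) - 3].
Proof.
split.
- exact: copula_psi.
- exact: R2_pit.
- exact: spearman_rho_product_moment.
Qed.
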